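(* Let $K$ be a non-empty compact metric space and let $A\subset[0,\overline{\dim}_B\,K]$. Then the following are equivalent: (1) There is a compact set $\mathcal{C}\subset\mathcal{K}(K)$ with $\{\overline{\dim}_B\,C: C\in\mathcal{C}\}=A$; (2) $A$ is an analytic set.
   Context: $\mathcal{K}(K)$ denotes the set of non-empty compact subsets of $K$ endowed with the Hausdorff metric; the family $\mathcal{C}$ may be empty. For a metric space $X$ let $N_n(X)$ be the minimal number of closed balls of radius at most $2^{-n}$ needed to cover $X$; the upper box dimension is $\overline{\dim}_B\,X=\limsup_{n\to\infty}\frac{\log N_n(X)}{n\log 2}$ (it may be $+\infty$ for a compact metric space, in which case the interval $[0,\overline{\dim}_B\,K]$ is taken in the extended reals). A set $A$ is analytic if it is the image of a (possibly empty) Polish space under a continuous map; in particular $\emptyset$ is analytic. *)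

(* Defs.v *)
From HB Require Import structures.
From mathcomp Require Import all_boot all_order all_algebra.
From mathcomp Require Import all_classical all_reals all_analysis.

Set Implicit Arguments.
Unset Strict Implicit.
Unset Printing Implicit Defensive.

Import Order.TTheory GRing.Theory Num.Theory.

Local Open Scope classical_set_scope.
Local Open Scope ring_scope.

(* The library's [closed_ball x r] is the closure of the open ball, which in a
   general metric space can be smaller than the closed ball below. *)
Definition mclosed_ball (R : realType) (X : metricType R) (x : X) (r : R) :
  set X := [set y | mdist x y <= r].

(* A list of (center, radius) pairs. The centers lie in [C], since the balls
   are those of the metric space [C], not of the ambient space [X]. *)
Definition ball_cover (R : realType) (X : metricType R) (C : set X) (n : nat)
    (s : seq (X * R)) : Prop :=
  (forall p, p \in s -> C p.1 /\ 0 < p.2 <= 2 ^- n) /\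
  C `<=` \bigcup_(p in [set` s]) mclosed_ball p.1 p.2.

(* The infimum is [+oo] when there is no finite cover, and otherwise is
   attained, being taken over natural numbers. *)
Definition covering_number (R : realType) (X : metricType R) (C : set X)
    (n : nat) : \bar R :=
  ereal_inf [set ((size s)%:R)%:E | s in ball_cover C n].

(* The term for n = 0, where [0^-1 = 0], does not affect the upper limit. *)
Definition upper_box_dim (R : realType) (X : metricType R) (C : set X) :
    \bar R :=
  limn_esup (fun n : nat =>
    (lne (covering_number C n) * ((n%:R * ln 2)^-1)%:E)%E).

Record hyperspace (R : realType) (X : metricType R) := Hyperspace {
  hyperspace_set :> set X ;
  hyperspace_compact : compact hyperspace_set ;
  hyperspace_neq0 : hyperspace_set !=set0
}.

Section hausdorff_metric.
Context (R : realType) (X : metricType R).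
Implicit Types (A B C : hyperspace X) (e : R).

Definition thickening (S : set X) e : set X :=
  [set x | exists2 y, S y & mdist x y <= e].

Definition hausdorff_radii (S T : set X) : set R :=
  [set e | [/\ 0 <= e, S `<=` thickening T e & T `<=` thickening S e]].

Definition hausdorff_dist A B : R := inf (hausdorff_radii A B).

Lemma hyperspace_inj A B : A = B :> set X -> A = B.
Proof.
case: A B => [S cS S0] [T cT T0] /= ST; subst T.
by congr Hyperspace; exact: Prop_irrelevance.
Qed.

Lemma compact_mdist_le (S : set X) (x : X) : compact S ->
  exists2 M : R, 0 <= M & forall y, S y -> mdist x y <= M.
Proof.
move=> /compact_near_coveringP cS.
have /cS : forall y, S y ->
    \forall y' \near y & n \near \oo, mdist x y' < n%:R :> R.
  move=> y _; exists (ball y 1, [set n | mdist x y + 1 < n%:R]) => /=.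
    split; first exact: nbhsx_ballx.
    exact: nbhs_infty_gtr.
  move=> [y' n]/= [yy' yn]; apply: le_lt_trans yn.
  rewrite (le_trans (metric_triangle _ y _))// lerD2l.
  by move: yy'; rewrite ballEmdist/= => /ltW.
by move=> [n _ /(_ n (leqnn n)) Sn]; exists n%:R => // y /Sn/ltW.
Qed.

Lemma hausdorff_radii_neq0 A B : hausdorff_radii A B !=set0.
Proof.
have [a Aa] := hyperspace_neq0 A; have [b Bb] := hyperspace_neq0 B.
have [M M0 AM] := compact_mdist_le b (@hyperspace_compact _ _ A).
have [N N0 BN] := compact_mdist_le a (@hyperspace_compact _ _ B).
exists (M + N); split; first exact: addr_ge0.
- move=> x Ax; exists b => //; rewrite metric_sym.
  by rewrite (le_trans (AM _ Ax))// lerDl.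
- move=> y By; exists a => //; rewrite metric_sym.
  by rewrite (le_trans (BN _ By))// lerDr.
Qed.

Lemma hausdorff_radii_has_inf A B : has_inf (hausdorff_radii A B).
Proof.
by split; [exact: hausdorff_radii_neq0|exists 0 => e []].
Qed.

Lemma hausdorff_dist_le A B e : hausdorff_radii A B e -> hausdorff_dist A B <= e.
Proof. by move=> ABe; apply: ge_inf => //; exists 0 => r []. Qed.

Lemma hausdorff_dist_ge0 A B : 0 <= hausdorff_dist A B.
Proof.
by apply: lb_le_inf; [exact: hausdorff_radii_neq0|move=> e []].
Qed.

Lemma hausdorff_distxx A : hausdorff_dist A A = 0.
Proof.
apply/eqP; rewrite eq_le hausdorff_dist_ge0 andbT hausdorff_dist_le//.
by split=> // x Ax; exists x => //; rewrite mdistxx.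
Qed.

Lemma hausdorff_dist_sym A B : hausdorff_dist A B = hausdorff_dist B A.
Proof.
by congr inf; apply/seteqP; split => e [e0 AB BA]; split.
Qed.

Lemma hausdorff_dist_subset A B : hausdorff_dist A B = 0 -> A `<=` B.
Proof.
move=> AB0 x Ax.
have : closed B.
  by apply: compact_closed (@hyperspace_compact _ _ B); exact: metric_hausdorff.
apply; move=> U /nbhs_ballP[e /= e0 eU].
have [r [r0 AB _] re] := inf_adherent e0 (hausdorff_radii_has_inf A B).
have [y By xy] := AB _ Ax; exists y; split => //; apply: eU.
rewrite ballEmdist/= (le_lt_trans xy)//.
by move: re; rewrite -/(hausdorff_dist A B) AB0 add0r.
Qed.

Lemma hausdorff_dist_positivity A B : hausdorff_dist A B = 0 -> A = B.
Proof.
move=> AB0; apply: hyperspace_inj; apply/seteqP; split.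
  exact: hausdorff_dist_subset.
by apply: hausdorff_dist_subset; rewrite hausdorff_dist_sym.
Qed.

Lemma hausdorff_dist_triangle B A C :
  hausdorff_dist A C <= hausdorff_dist A B + hausdorff_dist B C.
Proof.
apply/ler_addgt0Pl => e e0; have e20 : 0 < e / 2 by rewrite divr_gt0.
have [r [r0 AB BA] re] := inf_adherent e20 (hausdorff_radii_has_inf A B).
have [s [s0 BC CB] se] := inf_adherent e20 (hausdorff_radii_has_inf B C).
have rsE : r + s <= e + (hausdorff_dist A B + hausdorff_dist B C).
  by rewrite [e]splitr addrACA ![e / 2 + _]addrC lerD// ltW.
apply: le_trans rsE; apply: hausdorff_dist_le; split; first exact: addr_ge0.
- move=> x /AB[y /BC[z Cz yz] xy]; exists z => //.
  by rewrite (le_trans (metric_triangle _ y _))// lerD.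
- move=> z /CB[y /BA[x Ax yx] zy]; exists x => //.
  by rewrite (le_trans (metric_triangle _ y _))// addrC lerD.
Qed.

End hausdorff_metric.

HB.instance Definition _ (R : realType) (X : metricType R) :=
  gen_eqMixin (hyperspace X).
HB.instance Definition _ (R : realType) (X : metricType R) :=
  gen_choiceMixin (hyperspace X).
HB.instance Definition _ (R : realType) (X : metricType R) :=
  isMetric.Build R (hyperspace X) (@hausdorff_distxx R X)
    (@hausdorff_dist_positivity R X) (@hausdorff_dist_sym R X)
    (@hausdorff_dist_triangle R X).

Definition separable (T : topologicalType) : Prop :=
  exists2 D : set T, countable D & dense D.

(* The library's complete (pseudo)metric types are pointed; stating the axioms
   for a distance function on [T] also covers the empty space. *)
Definition completely_metrizable (R : realType) (T : topologicalType) : Prop :=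
  exists d : T -> T -> R,
    [/\ forall x y, d x y = 0 <-> x = y,
        forall x y, d x y = d y x,
        forall x y z, d x z <= d x y + d y z,
        forall x, nbhs x =
          filter_from [set e : R | 0 < e] (fun e => [set y | d x y < e])
      & forall u : nat -> T,
          (forall e : R, 0 < e -> exists N : nat,
            forall m n : nat, (N <= m)%N -> (N <= n)%N -> d (u m) (u n) < e) ->
          exists l : T, u @ \oo --> l].

Definition polish (R : realType) (T : topologicalType) : Prop :=
  separable T /\ completely_metrizable R T.

Definition analytic (R : realType) (Y : topologicalType) (A : set Y) : Prop :=
  exists (T : topologicalType) (f : T -> Y),
    [/\ polish R T, continuous f & range f = A].

(* Main.v *)
Require Import Defs.
From HB Require Import structures.
From mathcomp Require Import all_boot all_order all_algebra.
From mathcomp Require Import all_classical all_reals all_analysis.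
From mathcomp Require Import ring lra.

Set Implicit Arguments.
Unset Strict Implicit.
Unset Printing Implicit Defensive.

Import Order.TTheory GRing.Theory Num.Theory.
Import numFieldNormedType.Exports.

Local Open Scope classical_set_scope.
Local Open Scope ring_scope.

(* (1) => (2). The covering numbers are lower semicontinuous functions of the
   compact set, so the graph of the upper box dimension over a compact family is
   a countable intersection of countable unions of closed sets. Adding to its
   points a sequence recording in which closed set of each union they lie turns
   it into a Polish space, and [A] is its projection.

   (2) => (1). Let [T] be Polish and [f : T -> A] a continuous surjection. A
   point [z] of the Cantor space drives a walk in a dense sequence of [T] that
   makes steps of summable length, so that its position [y_m] at time [m], which
   depends on the first [m] bits only, always converges, and can converge to any
   point of [T]. By compactness some [x] has no neighbourhood of upper box
   dimension less than [d = dim K], and for every [t < d] there are finite sets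
   arbitrarily close to [x] whose covering numbers are at most about [2 ^ (n t)]
   for all [n], with near equality for some large [n]. Attach to [x] such sets
   [D_m] within distance [2 ^- m], for values [t_m < d] close to [f y_m]. Their
   union with [x] is compact, has dimension [lim t_m = lim f y_m], which is in
   [A], and depends continuously on [z]. *)

(** * Dyadic radii and upper limits *)

Section dyadic.
Context {R : realType}.

Lemma exp2V_gt0 n : 0 < 2 ^- n :> R.
Proof. by rewrite invr_gt0 exprn_gt0. Qed.

Lemma exp2V_ge0 n : 0 <= 2 ^- n :> R.
Proof. exact/ltW/exp2V_gt0. Qed.

Lemma ler_exp2V m n : (2 ^- m <= 2 ^- n :> R) = (n <= m)%N.
Proof. by rewrite lef_pV2 ?posrE ?exprn_gt0// ler_eXn2l ?ltr1n. Qed.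

Lemma exp2V_double n : 2 ^- n = 2 ^- n.+1 + 2 ^- n.+1 :> R.
Proof. by rewrite exprSr invfM -mulrDr -[LHS]mulr1; congr (_ * _); field. Qed.

Lemma ex_exp2V_lt (e : R) : 0 < e -> exists n, 2 ^- n < e.
Proof.
move=> e0.
have [n _ /(_ n (leqnn n))/=] := near_infty_natSinv_expn_lt (PosNum e0).
by rewrite div1r; exists n.
Qed.

End dyadic.

Section limn_esup.
Context {R : realType}.
Implicit Types (u : (\bar R)^nat) (l : \bar R).
Local Open Scope ereal_scope.

Lemma lt_ereal_rat l1 l2 : l1 < l2 ->
  exists q : rat, l1 < (ratr q)%:E < l2.
Proof.
case: l1 l2 => [r||] [s||]//; rewrite ?ltNyy//.
- by rewrite lte_fin => /rat_in_itvoo[q]; rewrite in_itv/= => rqs; exists q.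
- have /rat_in_itvoo[q] : (r < r + 1)%R by rewrite ltrDl.
  by rewrite in_itv/= => /andP[rq _] _; exists q; rewrite ltry lte_fin rq.
- have /rat_in_itvoo[q] : (s - 1 < s)%R by rewrite ltrBlDr ltrDl.
  by rewrite in_itv/= => /andP[_ qs] _; exists q; rewrite ltNyr lte_fin.
- by exists 0%R; rewrite ltNyr ltry.
Qed.

(** Thresholds are rational so that bounds on an upper limit become countably many conditions. *)
Lemma limn_esup_leP u l : limn_esup u <= l <->
  forall q : rat, l < (ratr q)%:E ->
    exists N, forall n, (N <= n)%N -> u n <= (ratr q)%:E.
Proof.
split=> [ul q lq|H].
  have : limn_esup u < (ratr q)%:E by exact: le_lt_trans lq.
  move=> /ereal_inf_lt[_ [V [N _ NV] <-] Vq]; exists N => n Nn.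
  apply: le_trans (ltW Vq); apply: ereal_sup_ubound.
  by exists n => //; exact: NV.
rewrite leNgt; apply/negP => /lt_ereal_rat[q /andP[lq qu]].
have [N uN] := H q lq; move: qu; apply/negP; rewrite -leNgt.
apply: ereal_inf_le; exists (ereal_sup (u @` [set n | (N <= n)%N])).
  by exists [set n | (N <= n)%N] => //; exists N.
by apply: ge_ereal_sup => _ [n Nn <-]; exact: uN.
Qed.

Lemma limn_esup_geP u l : l <= limn_esup u <->
  forall (q : rat) N, (ratr q)%:E < l ->
    exists2 n, (N <= n)%N & (ratr q)%:E < u n.
Proof.
split=> [ul q N lq|H].
  have : (ratr q)%:E < ereal_sup (u @` [set n | (N <= n)%N]).
    apply: lt_le_trans lq (le_trans ul _); apply: ereal_inf_lbound.
    by exists [set n | (N <= n)%N] => //; exists N.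
  by move=> /ereal_sup_gt[_ [n Nn <-] qn]; exists n.
rewrite leNgt; apply/negP => /lt_ereal_rat[q /andP[lq qu]].
move: lq => /ereal_inf_lt[_ [V [N _ NV] <-]]; apply/negP; rewrite -leNgt.
have [n Nn qn] := H q N qu; apply: le_trans (ltW qn) _.
by apply: ereal_sup_ubound; exists n => //; exact: NV.
Qed.

End limn_esup.

(** * Polish spaces of witnesses *)

Section sequence_metric.
Context (R : realType).
Implicit Types u v w : nat -> nat.

(* The usual ultrametric on the Baire space, [2 ^- k] where [k] is the first
   index at which the sequences differ. *)
Definition seq_dist u v : R :=
  inf [set 2 ^- n | n in [set n | forall i, (i < n)%N -> u i = v i]].

Let lb u v : has_lbound
  [set (2 ^- n : R) | n in [set n | forall i, (i < n)%N -> u i = v i]].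
Proof. by exists 0 => _ [n _ <-]; rewrite exp2V_ge0. Qed.

Lemma seq_dist_le u v n : (forall i, (i < n)%N -> u i = v i) ->
  seq_dist u v <= 2 ^- n.
Proof. by move=> uv; apply: ge_inf => //; exists n. Qed.

Lemma seq_dist_ge u v k : u k != v k -> 2 ^- k <= seq_dist u v.
Proof.
move=> uvk; apply: lb_le_inf; first by exists (2 ^- 0), 0%N.
move=> _ [n uvn <-]; rewrite ler_exp2V// leqNgt; apply/negP => /uvn uvk'.
by rewrite uvk' eqxx in uvk.
Qed.

Lemma seq_dist_ge0 u v : 0 <= seq_dist u v.
Proof.
apply: lb_le_inf; first by exists (2 ^- 0), 0%N.
by move=> _ [n _ <-]; rewrite exp2V_ge0.
Qed.

Lemma seq_distxx u : seq_dist u u = 0.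
Proof.
apply/eqP; rewrite eq_le seq_dist_ge0 andbT; apply/ler_addgt0Pl => e e0.
rewrite addr0; have [n /ltW] := ex_exp2V_lt e0.
by apply: le_trans; exact: seq_dist_le.
Qed.

Lemma seq_dist_lt u v i n : seq_dist u v < 2 ^- n -> (i <= n)%N -> u i = v i.
Proof.
move=> uvn ni; apply/eqP; apply: contraTT uvn => /seq_dist_ge uvi.
by rewrite -leNgt (le_trans _ uvi)// ler_exp2V.
Qed.

Lemma seq_dist_positivity u v : seq_dist u v = 0 -> u = v.
Proof.
move=> uv0; apply/funext => i; apply: (@seq_dist_lt _ _ _ i) => //.
by rewrite uv0 exp2V_gt0.
Qed.

Lemma seq_dist_sym u v : seq_dist u v = seq_dist v u.
Proof.
congr inf; apply/seteqP; split => _ [n uvn <-]; exists n => // i /uvn//.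
Qed.

Lemma seq_dist_triangle v u w :
  seq_dist u w <= seq_dist u v + seq_dist v w.
Proof.
have [->|/eqP uw] := pselect (u = w).
  by rewrite seq_distxx addr_ge0// seq_dist_ge0.
have /ex_minnP[k uwk kmin] : exists k, u k != w k.
  apply: contrapT => /forallNP uwE; move/eqP: uw; apply; apply/funext => k.
  by apply/eqP; apply: contrapT => uwk; apply: (uwE k); exact/negP.
have uwkE : seq_dist u w <= 2 ^- k.
  apply: seq_dist_le => i ik; apply/eqP; apply: contraTT ik => /kmin.
  by rewrite leqNgt.
apply: le_trans uwkE _; have [uvk|uvk] := eqVneq (u k) (v k).
  by rewrite (le_trans (@seq_dist_ge v w k _)) ?lerDr ?seq_dist_ge0// -uvk.
by rewrite (le_trans (seq_dist_ge uvk))// lerDl seq_dist_ge0.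
Qed.

End sequence_metric.
(* If not, the complements in [S] of the sets in [P] form a proper filter, which
   has no cluster point in [S]. *)
Lemma compact_ideal (X : topologicalType) (S : set X) (P : set X -> Prop) :
  compact S -> P set0 -> (forall A B, P A -> P B -> P (A `|` B)) ->
  (forall A B, A `<=` B -> P B -> P A) ->
  (forall x, S x -> exists2 U, nbhs x U & P U) -> P S.
Proof.
move=> Sc P0 PU Psub Ploc; apply: contrapT => nPS.
pose F : set_system X := [set A | P (S `\` A)].
have FF : ProperFilter F.
  split; first by rewrite /F/= setD0.
  split; first by rewrite /F/= setDT.
  - by move=> A B FA FB; rewrite /F/= setDIr; exact: PU.
  - by move=> A B AB; apply: Psub => x [Sx nBx]; split => // /AB.
have [|x [Sx Fx]] := Sc F FF; first by rewrite /F/= setDv.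
have [U xU PU'] := Ploc x Sx.
have [|y []//] := Fx (~` U) U _ xU.
by apply: Psub PU'; rewrite setDE setCK; exact: subIsetr.
Qed.

Lemma compact_finite_net (R : realType) (X : metricType R) (S : set X) (r : R) :
  compact S -> 0 < r -> exists2 s : seq X, (forall p, p \in s -> S p) &
    forall x, S x -> exists2 p, p \in s & mdist p x < r.
Proof.
move=> Sc r0; apply: (compact_ideal (P := fun A => exists2 s : seq X,
  (forall p, p \in s -> S p) &
  forall x, A x -> exists2 p, p \in s & mdist p x < r) Sc).
- by exists [::].
- move=> A B [s sS sA] [t tS tB]; exists (s ++ t).
    by move=> p; rewrite mem_cat => /orP[/sS|/tS].
  move=> x [/sA|/tB] [p ps px]; exists p => //; rewrite mem_cat ps ?orbT//.
- by move=> A B AB [s sS sB]; exists s => // x /AB/sB.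
- move=> x Sx; exists (ball x r); first exact: nbhsx_ballx.
  exists [:: x] => [p|y]; first by rewrite inE => /eqP ->.
  by rewrite ballEmdist; exists x; rewrite ?mem_head.
Qed.

Lemma compact_cauchy_seq_cvg (R : realType) (X : metricType R) (S : set X)
    (u : nat -> X) : compact S -> (forall n, S (u n)) ->
  (forall e : R, 0 < e -> exists N : nat, forall m n,
    (N <= m)%N -> (N <= n)%N -> mdist (u m) (u n) < e) ->
  exists2 l, S l & u @ \oo --> l.
Proof.
move=> Sc Su uC; have [l [Sl ul]] : exists l, S l /\ cluster (u @ \oo) l.
  by apply: Sc; exists 0%N => // n _; exact: Su.
exists l => //; apply/metricType_numDomainType.cvgrPdist_lt => e e0.
have e20 : 0 < e / 2 by rewrite divr_gt0.
have [N uN] := uC _ e20; exists N => // n /= Nn.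
have [|_ [[m Nm <-] lm]] := ul (u @` [set m | (N <= m)%N]) _ _
  (nbhsx_ballx _ _ e20); first by exists N => // m /= Nm; exists m.
rewrite ballEmdist/= in lm.
by rewrite (le_lt_trans (metric_triangle _ (u m) _))// [e]splitr ltrD// uN.
Qed.

(** One point is picked for each level and each attained code. These countably many points are
    dense, since sharing a code at a fine level forces closeness. *)
Lemma dense_of_codes (R : realType) (T : metricType R)
    (c : nat -> T -> nat) :
  (forall e : R, 0 < e -> exists n, forall p q, c n p = c n q ->
    mdist p q < e) -> separable T.
Proof.
move=> cT; have [[p0]|T0] := pselect (exists p : T, True); last first.
  exists set0; first exact: countable0.
  by move=> O [x Ox]; exfalso; apply: T0; exists x.
pose g (nk : nat * nat) := xget p0 [set p | c nk.1 p = nk.2].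
exists (range g).
  by apply: (sub_countable (card_image_le _ _)); exact: countableP.
move=> O [x Ox]; rewrite openE => /(_ x Ox)/nbhs_ballP[e /= e0 eO].
have [n cn] := cT e e0; exists (g (n, c n x)); split; last by exists (n, c n x).
apply: eO; rewrite ballEmdist/=; apply: cn.
rewrite /g; case: xgetP => [y _ /= yn|/(_ x) []//].
exact: esym.
Qed.

(** A point of [\bigcap_m \bigcup_n F m n] over [S], with a chosen [n] for each [m]. For closed
    [F m n] the witnesses form a closed subset of a product with the Baire space, while the
    intersection itself need not be Polish. *)
Record witness (R : realType) (X : metricType R) (S : set X)
    (F : nat -> nat -> set (X * \bar R)) := Witness {
  witness_point : X ;
  witness_value : \bar R ;
  witness_choice : nat -> nat ;
  witness_in : S witness_point ;
  witnessP : forall m,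
    F m (witness_choice m) (witness_point, witness_value) }.

Section witness_metric.
Context (R : realType) (X : metricType R) (S : set X).
Context (F : nat -> nat -> set (X * \bar R)).
Implicit Types p q r : witness S F.

Definition witness_dist p q : R :=
  mdist (witness_point p) (witness_point q)
  + `|contract (witness_value p) - contract (witness_value q)|
  + seq_dist R (witness_choice p) (witness_choice q).

Lemma witness_point_dist p q :
  mdist (witness_point p) (witness_point q) <= witness_dist p q.
Proof. by rewrite /witness_dist -addrA lerDl addr_ge0// seq_dist_ge0. Qed.

Lemma witness_value_dist p q :
  `|contract (witness_value p) - contract (witness_value q)|
    <= witness_dist p q.
Proof.
by rewrite /witness_dist addrAC lerDr addr_ge0 ?mdist_ge0// seq_dist_ge0.
Qed.

Lemma witness_choice_dist p q :
  seq_dist R (witness_choice p) (witness_choice q) <= witness_dist p q.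
Proof. by rewrite /witness_dist lerDr addr_ge0// mdist_ge0. Qed.

Lemma witness_distxx p : witness_dist p p = 0.
Proof. by rewrite /witness_dist mdistxx subrr normr0 seq_distxx !addr0. Qed.

Lemma witness_dist_sym p q : witness_dist p q = witness_dist q p.
Proof. by rewrite /witness_dist metric_sym distrC seq_dist_sym. Qed.

Lemma witness_dist_triangle q p r :
  witness_dist p r <= witness_dist p q + witness_dist q r.
Proof.
rewrite /witness_dist addrACA lerD ?seq_dist_triangle// addrACA lerD//.
  exact: metric_triangle.
exact: ler_distD.
Qed.

Lemma witness_dist_positivity p q : witness_dist p q = 0 -> p = q.
Proof.
move=> pq0; have := witness_choice_dist p q.
have := witness_value_dist p q; have := witness_point_dist p q.
rewrite pq0; case: p q {pq0} => [x t u xS xF] [y s v yS yF]/=.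
rewrite le_eqVlt ltNge mdist_ge0 orbF => /eqP/mdist_positivity xy.
rewrite normr_le0 subr_eq0 => /eqP/contract_inj ts.
rewrite le_eqVlt ltNge seq_dist_ge0 orbF => /eqP/seq_dist_positivity uv.
subst y s v; congr Witness; exact: Prop_irrelevance.
Qed.

End witness_metric.

HB.instance Definition _ (R : realType) (X : metricType R) (S : set X) F :=
  gen_eqMixin (witness S F).
HB.instance Definition _ (R : realType) (X : metricType R) (S : set X) F :=
  gen_choiceMixin (witness S F).
HB.instance Definition _ (R : realType) (X : metricType R) (S : set X) F :=
  isMetric.Build R (witness S F) (@witness_distxx R X S F)
    (@witness_dist_positivity R X S F) (@witness_dist_sym R X S F)
    (@witness_dist_triangle R X S F).

Section witness_polish.
Context (R : realType) (X : metricType R) (S : set X).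
Context (F : nat -> nat -> set (X * \bar R)).
Hypothesis Sc : compact S.

Lemma witness_value_continuous :
  continuous (@witness_value R X S F).
Proof.
move=> p V /nbhs_ballP[e /= e0 eV]; apply/nbhs_ballP; exists e => // q.
rewrite ballEmdist/= => pq; apply: eV.
exact: le_lt_trans (witness_value_dist p q) pq.
Qed.

Lemma witness_separable : separable (witness S F).
Proof.
have /choice[s sS] (n : nat) : exists s : seq X, forall x, S x ->
    exists2 y, y \in s & mdist y x < 2 ^- n.
  have [|s _ sS] := compact_finite_net (r := 2 ^- n) Sc; last by exists s.
  by rewrite exp2V_gt0.
(* The code at level [n] records a nearby net point, the contracted value rounded to a multiple of
   [2 ^- n], and [n] choices. Equal codes give distance below [4 * 2 ^- n], the passage through the
   net point counting twice. *)
pose c n (p : witness S F) := pickle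
  (find (fun y => mdist y (witness_point p) < 2 ^- n) (s n),
   Num.truncn ((contract (witness_value p) + 1) * 2 ^+ n),
   [seq witness_choice p i | i <- iota 0 n]).
apply: (dense_of_codes (c := c)) => e e0.
have e40 : 0 < e / 4 by rewrite divr_gt0.
have [n ne] := ex_exp2V_lt e40.
exists n => p q /(pcan_inj pickleK)[pqx pqt pqw].
rewrite /mdist/= /witness_dist.
have -> : e = e / 4 + e / 4 + e / 4 + e / 4 by field.
apply: ltr_leD; last first.
  apply: le_trans (seq_dist_le R (n := n) _) (ltW ne) => i ni.
  have := congr1 (nth 0%N ^~ i) pqw.
  by rewrite !(nth_map 0%N) ?size_iota// nth_iota.
apply: ltr_leD; last first.
  apply: le_trans (ltW ne).
  have t0 (r : witness S F) :
      0 <= (contract (witness_value r) + 1) * 2 ^+ n.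
    rewrite mulr_ge0 ?exprn_ge0// -lerBlDr sub0r.
    by have := contract_le1 (witness_value r); rewrite ler_norml => /andP[].
  have /andP[] := truncn_itv (t0 p); have /andP[] := truncn_itv (t0 q).
  rewrite -pqt; set k := Num.truncn _.
  set P := (contract (witness_value p) + 1) * _.
  set Q := (contract (witness_value q) + 1) * _.
  rewrite -natr1 => kQ Qk kP Pk.
  rewrite -[2 ^- n]div1r ler_pdivlMr ?exprn_gt0//.
  rewrite -[X in _ * X]ger0_norm ?exprn_ge0// -normrM.
  have -> : (contract (witness_value p) - contract (witness_value q)) * 2 ^+ n
      = P - Q by rewrite /P /Q; ring.
  rewrite ler_norml; lra.
have hs (r : witness S F) :
    has (fun y => mdist y (witness_point r) < 2 ^- n) (s n).
  by have [y ys yr] := sS n _ (witness_in r); apply/hasP; exists y.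
have := nth_find (witness_point p) (hs p).
have := nth_find (witness_point p) (hs q).
rewrite -pqx; set y := nth _ _ _ => yq yp.
rewrite (le_lt_trans (metric_triangle _ y _))// metric_sym.
by rewrite ltrD// (lt_trans _ ne).
Qed.

Hypothesis Fcl : forall m n, closed (F m n).

(** Points and contracted values converge by compactness, and each entry of the choices is
    eventually constant. The limit satisfies condition [m] because [F m (w m)] is closed. *)
Lemma witness_complete (p : nat -> witness S F) :
  (forall e : R, 0 < e -> exists N : nat, forall m n : nat,
    (N <= m)%N -> (N <= n)%N -> mdist (p m) (p n) < e) ->
  exists l : witness S F, p @ \oo --> l.
Proof.
move=> pC.
have [|x Sx px] := @compact_cauchy_seq_cvg R X S
    (fun n => witness_point (p n)) Sc (fun n => witness_in (p n)).
  move=> e /pC[N pN]; exists N => m n Nm Nn.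
  exact: le_lt_trans (witness_point_dist _ _) (pN m n Nm Nn).
have [|||a a1 pa] := @compact_cauchy_seq_cvg R R^o `[-1, 1]
    (fun n => contract (witness_value (p n))).
- exact: segment_compact.
- by move=> n /=; rewrite in_itv/= -ler_norml contract_le1.
- move=> e /pC[N pN]; exists N => m n Nm Nn.
  by apply: le_lt_trans (pN n m Nn Nm); exact: witness_value_dist.
have ca : contract (expand a) = a.
  by rewrite expandK// inE/= ler_norml; move: a1; rewrite /= in_itv.
have pt : (fun n => witness_value (p n)) @ \oo --> expand a.
  move=> V /nbhs_ballP[e /= e0 eV].
  have /metricType_numDomainType.cvgrPdist_lt/(_ _ e0) := pa.
  apply: filterS => n; rewrite /mdist/= => pan; apply: eV.
  by rewrite /ball/= /ereal_ball ca distrC.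
have /choice[N pN] : forall i : nat, exists N, forall m, (N <= m)%N ->
    witness_choice (p m) i = witness_choice (p N) i.
  move=> i; have [|N pN] := pC (2 ^- i); first by rewrite exp2V_gt0.
  exists N => m Nm; apply: (@seq_dist_lt R _ _ _ i) => //.
  by apply: le_lt_trans (pN m N Nm _) => //; exact: witness_choice_dist.
pose w i := witness_choice (p (N i)) i.
have xtF m : F m (w m) (x, expand a).
  apply: (@closed_cvg _ _ \oo _
    (fun n => (witness_point (p n), witness_value (p n)))) => //.
    by exists (N m) => // n /= Nn; rewrite /w -(pN m n Nn); exact: witnessP.
  exact: cvg_pair.
exists (Witness Sx xtF); apply/metricType_numDomainType.cvgrPdist_le => e e0.
have e30 : 0 < e / 3 by rewrite divr_gt0.
have wN k : exists M, forall m, (M <= m)%N -> forall i, (i < k)%N ->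
    w i = witness_choice (p m) i.
  elim: k => [|k [M wM]]; first by exists 0%N.
  exists (maxn M (N k)) => m; rewrite geq_max => /andP[Mm Nm] i.
  by rewrite ltnS leq_eqVlt => /predU1P[->|ik]; [rewrite pN|exact: wM].
have [n ne] := ex_exp2V_lt e30.
have [M wM] := wN n.
near=> m; rewrite /mdist/= /witness_dist/=.
rewrite (_ : e = e / 3 + e / 3 + e / 3); last by field.
rewrite lerD//; last first.
  apply: le_trans (seq_dist_le _ (wM m _)) _; first by near: m; exists M.
  by rewrite ltW.
rewrite lerD//; last first.
  rewrite ca distrC; near: m.
  have /metricType_numDomainType.cvgrPdist_le/(_ _ e30) := pa.
  exact: filterS.
by near: m; have /metricType_numDomainType.cvgrPdist_le/(_ _ e30) := px.
Unshelve. all: by end_near. Qed.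

Lemma witness_polish : polish R (witness S F).
Proof.
split; first exact: witness_separable.
exists (@mdist R (witness S F)); split => //.
- by move=> p q; split => [/mdist_positivity//|->]; rewrite mdistxx.
- exact: metric_sym.
- by move=> p q r; exact: metric_triangle.
- by move=> p; rewrite metricType_numDomainType.filter_from_mdist_nbhs.
- exact: witness_complete.
Qed.

End witness_polish.
Lemma analytic_of_closed (R : realType) (X : metricType R) (S : set X)
    (I J : countType) (F : I -> J -> set (X * \bar R)) :
  compact S -> (forall i j, closed (F i j)) ->
  analytic R [set t | exists2 x, S x & forall i, exists j, F i j (x, t)].
Proof.
move=> Sc Fcl.
(* A number [m] that codes no element of [I] imposes no condition; an [n] that codes no element of
   [J] is never a valid choice. *)
pose G m n : set (X * \bar R) :=
  if unpickle m is Some i then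
    if unpickle n is Some j then F i j else set0
  else setT.
have Gcl m n : closed (G m n).
  rewrite /G; case: (unpickle m) => [i|]; last exact: closedT.
  by case: (unpickle n) => [j|]; [exact: Fcl|exact: closed0].
exists (witness S G), (@witness_value R X S G); split.
- exact: witness_polish.
- exact: witness_value_continuous.
apply/seteqP; split=> [_ [p _ <-]|t [x Sx xtF]].
  exists (witness_point p); first exact: witness_in.
  move=> i; have := witnessP p (pickle i); rewrite /G pickleK.
  by case: (unpickle _) => [j|//]; exists j.
have /choice[w wG] : forall m, exists n, G m n (x, t).
  move=> m; rewrite /G; case: (unpickle m) => [i|]; last by exists 0%N.
  by have [j ij] := xtF i; exists (pickle j); rewrite pickleK.
by exists (Witness Sx wG).
Qed.

(** A point of the ball outside [U] stays in the balls about nearby centres. Letting [r] run through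
    [2 ^- l] exhausts an open [U] by countably many closed sets. *)
Lemma closed_ball_subset (R : realType) (X : metricType R) (U : set X) (r : R) :
  closed [set x | ball x r `<=` U].
Proof.
rewrite -openC openE => x /= /existsNP[y /not_implyP[]].
rewrite ballEmdist/= => xy yU; apply/nbhs_ballP.
exists (r - mdist x y); rewrite /= ?subr_gt0// => z.
rewrite ballEmdist/= => xz zU; apply/yU/zU; rewrite ballEmdist/=.
rewrite (le_lt_trans (metric_triangle _ x _))// metric_sym.
by rewrite -ltrBrDr.
Qed.

(* [t] is the upper limit at [x] if and only if for every rational [q], either
   [q <= t] or eventually [phi n x <= q], and either [t <= q] or infinitely
   often [q < phi n x]; the last condition is a countable union of closed
   ones. *)
Lemma analytic_limn_esup (R : realType) (X : metricType R) (S : set X)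
    (phi : nat -> X -> \bar R) :
  compact S -> (forall n, lower_semicontinuous (phi n)) ->
  analytic R [set limn_esup (phi ^~ x) | x in S].
Proof.
move=> Sc phi_lsc.
(* [inl] indexes the upper bounds and [inr] the lower ones. [None] picks the alternative on [t];
   [Some] carries the starting index [N], respectively the index [n] and a radius exponent [l]. *)
pose F (i : rat + rat * nat) (j : option (nat * nat)) : set (X * \bar R) :=
  match i, j with
  | inl q, None => [set p | ((ratr q)%:E <= p.2)%E]
  | inl q, Some (N, _) =>
      \bigcap_(n in [set n | (N <= n)%N])
        [set p | (phi n p.1 <= (ratr q)%:E)%E]
  | inr (q, N), None => [set p | (p.2 <= (ratr q)%:E)%E]
  | inr (q, N), Some (n, l) =>
      if (N <= n)%N
      then [set p | ball p.1 (2 ^- l) `<=` [set x | ((ratr q)%:E < phi n x)%E]]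
      else set0
  end.
have Fcl i j : closed (F i j).
  case: i j => [q|[q N]] [[n l]|]/=.
  - apply: closed_bigI => m _.
    rewrite (_ : [set _ | _] =
        fst @^-1` ~` [set x | ((ratr q)%:E < phi m x)%E]).
      apply: closed_comp => [p _|]; first exact: cvg_fst.
      by rewrite closedC; move/lower_semicontinuousP: (phi_lsc m); exact.
    by apply/seteqP; split => p /=; rewrite leNgt => /negP.
  - apply: (@closed_comp _ _ snd [set t | ((ratr q)%:E <= t)%E]) => [p _|].
      exact: cvg_snd.
    exact: closed_ereal_le_ereal.
  - case: ifP => _; last exact: closed0.
    apply: (@closed_comp _ _ fst [set x | ball x (2 ^- l) `<=` _]) => [p _|].
      exact: cvg_fst.
    exact: closed_ball_subset.
  - apply: (@closed_comp _ _ snd [set t | (t <= (ratr q)%:E)%E]) => [p _|].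
      exact: cvg_snd.
    exact: closed_ereal_ge_ereal.
have := analytic_of_closed Sc Fcl; congr (analytic R _).
apply/seteqP; split=> [t [x Sx xtF]|_ [x Sx <-]]; exists x => //.
  apply/eqP; rewrite eq_le; apply/andP; split.
    apply/limn_esup_leP => q tq; have [[[N k]|]/= xtFq] := xtF (inl q).
      by exists N.
    by move: tq; rewrite ltNge xtFq.
  apply/limn_esup_geP => q N qt; have [[[n l]|]/=] := xtF (inr (q, N)).
    case: ifP => // Nn xq; exists n => //; apply: xq.
    by rewrite ballEmdist/= mdistxx exp2V_gt0.
  by rewrite leNgt qt.
case=> [q|[q N]].
  have [|tq] := leP ((ratr q)%:E)%E (limn_esup (phi ^~ x)).
    by exists None.
  have /limn_esup_leP/(_ _ tq)[N Nq] := lexx (limn_esup (phi ^~ x)).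
  by exists (Some (N, 0%N)).
have [|tq] := leP (limn_esup (phi ^~ x)) ((ratr q)%:E)%E; first by exists None.
have /limn_esup_geP/(_ _ N tq)[n Nn qn] := lexx (limn_esup (phi ^~ x)).
have [V /nbhs_ballP[e /= e0 eV] Vq] := phi_lsc n x _ qn.
have [l le] := ex_exp2V_lt e0.
exists (Some (n, l)); rewrite /= Nn => y xy; apply/Vq/eV.
by apply: le_ball xy; rewrite ltW.
Qed.
(** * Covering numbers *)

Section covering.
Context (R : realType) (X : metricType R).
Implicit Types (C D : set X) (n k : nat) (s : seq X).

Definition coverable C n k := exists s, [/\ (forall p, p \in s -> C p),
  forall x, C x -> exists2 p, p \in s & mdist p x <= 2 ^- n & (size s <= k)%N].

Definition ncov C n : nat :=
  if pselect (exists k, `[<coverable C n k>]) is left cC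
  then ex_minn cC else 0%N.

Hypothesis Xc : compact [set: X].

(** Centres must lie in [D]: every ball meeting [D] is recentred at a point of [D], which doubles
    the radius. The lost level does not affect the dimension. *)
Lemma subset_coverable C D n k : D `<=` C -> coverable C n.+1 k ->
  coverable D n k.
Proof.
move=> DC [s [_ sC sk]].
have /choice[f fP] : forall p, exists o : option X,
    (if o is Some y then D y /\ mdist p y <= 2 ^- n.+1
     else forall y, D y -> ~ mdist p y <= 2 ^- n.+1).
  move=> p; have [[y [Dy py]]|no] := pselect (exists y, D y /\
    mdist p y <= 2 ^- n.+1); first by exists (Some y).
  by exists None => y Dy py; apply: no; exists y.
exists (pmap f s); split.
- move=> y; rewrite mem_pmap => /mapP[p ps fpy].
  by have := fP p; rewrite -fpy => -[].
- move=> x Dx; have [p ps px] := sC _ (DC _ Dx); have := fP p.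
  case fpy : (f p) => [y|]; last by move=> /(_ _ Dx).
  move=> [Dy py]; exists y; first by rewrite mem_pmap -fpy map_f.
  rewrite exp2V_double (le_trans (metric_triangle _ p _))// lerD//.
  by rewrite metric_sym.
- by rewrite size_pmap (leq_trans (count_size _ _)).
Qed.

Lemma ex_coverable C n : exists k, coverable C n k.
Proof.
have [|s _ sX] := compact_finite_net (r := 2 ^- n.+1) Xc.
  by rewrite exp2V_gt0.
exists (size s); apply: (@subset_coverable setT) => //.
by exists s; split => // x _; have [p ps /ltW px] := sX x I; exists p.
Qed.

Lemma coverableP C n k : coverable C n k <-> (ncov C n <= k)%N.
Proof.
rewrite /ncov; case: pselect => [h|[]]; last first.
  by have [j Cj] := ex_coverable C n; exists j; apply/asboolP.
case: ex_minnP => m /asboolP[s [sC Cs sm]] mmin; split=> [Ck|mk].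
  by apply: mmin; exact/asboolP.
by exists s; split => //; exact: leq_trans mk.
Qed.

(** Enlarging every radius to [2 ^- n] keeps a cover, so radii can be fixed. *)
Lemma covering_numberE C n : covering_number C n = ((ncov C n)%:R)%:E.
Proof.
apply/eqP; rewrite eq_le; apply/andP; split.
  have /coverableP[s [sC Cs sk]] := leqnn (ncov C n).
  apply: ereal_inf_le; exists ((size s)%:R)%:E; last by rewrite lee_fin ler_nat.
  exists [seq (p, 2 ^- n) | p <- s]; last by rewrite size_map.
  split=> [_ /mapP[p /sC Cp ->]|x /Cs[p ps px]].
    by split; rewrite // lexx exp2V_gt0.
  by exists (p, 2 ^- n) => //; exact: map_f.
apply: le_ereal_inf_tmp => _ [s [sC Cs] <-]; rewrite lee_fin ler_nat.
apply/coverableP; exists (map fst s); split; last by rewrite size_map.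
  by move=> _ /mapP[p /sC[Cp _] ->].
move=> x /Cs[p ps px]; exists p.1; first exact: map_f.
by have [_ /andP[_]] := sC _ ps; exact: le_trans.
Qed.

Lemma ncov_subset C D n : D `<=` C -> (ncov D n <= ncov C n.+1)%N.
Proof. by move=> DC; apply/coverableP/(subset_coverable DC)/coverableP. Qed.

Lemma ncovU C D n : (ncov (C `|` D) n <= ncov C n + ncov D n)%N.
Proof.
have /coverableP[s [sC Cs sk]] := leqnn (ncov C n).
have /coverableP[t [tD Dt tk]] := leqnn (ncov D n).
apply/coverableP; exists (s ++ t); split; last by rewrite size_cat leq_add.
  by move=> p; rewrite mem_cat => /orP[/sC|/tD]; [left|right].
by move=> x [/Cs|/Dt] [p ps px]; exists p; rewrite // mem_cat ps ?orbT.
Qed.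

Lemma ncov_le1 C n x : C x -> (forall y, C y -> mdist x y <= 2 ^- n) ->
  (ncov C n <= 1)%N.
Proof.
move=> Cx xC; apply/coverableP; exists [:: x]; split => //.
  by move=> p; rewrite inE => /eqP ->.
by move=> y /xC xy; exists x; rewrite ?mem_head.
Qed.

Lemma ncov0 n : ncov set0 n = 0%N.
Proof. by apply/eqP; rewrite -leqn0; apply/coverableP; exists [::]; split. Qed.

Lemma ncov_gt0 C n : C !=set0 -> (0 < ncov C n)%N.
Proof.
move=> [x Cx]; rewrite lt0n; apply/negP => /eqP C0.
have /coverableP[s [_ Cs]] := leqnn (ncov C n).
by rewrite C0 leqn0 size_eq0 => /eqP s0; have [p] := Cs x Cx; rewrite s0.
Qed.

Definition box_ratio C n : R := ln (ncov C n)%:R / (n%:R * ln 2).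

Lemma upper_box_dimE C : C !=set0 ->
  upper_box_dim C = limn_esup (fun n => (box_ratio C n)%:E).
Proof.
move=> C0; congr limn_esup; apply/funext => n.
by rewrite covering_numberE lne_EFin ?ltr0n ?ncov_gt0.
Qed.

Lemma box_ratio_le C D n : C !=set0 -> (ncov C n <= ncov D n)%N ->
  box_ratio C n <= box_ratio D n.
Proof.
move=> C0 CD; rewrite ler_wpM2r//.
  by rewrite invr_ge0 mulr_ge0// ln_ge0// ler1n.
have Cn := ncov_gt0 n C0.
by rewrite ler_ln ?posrE ?ltr0n ?ler_nat// (leq_trans Cn).
Qed.

Lemma lt_box_ratio C n q : C !=set0 -> (0 < n)%N ->
  (q < box_ratio C n) = (2 `^ (n%:R * q) < (ncov C n)%:R).
Proof.
move=> C0 n0; have l2 : 0 < ln (2 : R) by rewrite ln_gt0// ltr1n.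
rewrite ltr_pdivlMr ?mulr_gt0 ?ltr0n// mulrA [q * _]mulrC -ln_powR.
by rewrite ltr_ln// posrE ?powR_gt0// ltr0n ncov_gt0.
Qed.

Lemma box_ratio_le_powR C n q : C !=set0 -> (0 < n)%N ->
  (box_ratio C n <= q) = ((ncov C n)%:R <= 2 `^ (n%:R * q)).
Proof. by move=> C0 n0; rewrite leNgt lt_box_ratio// -leNgt. Qed.

End covering.

(** * Lower semicontinuity of covering numbers in the Hausdorff metric *)

Section hyperspace_covering.
Context (R : realType) (X : metricType R).
Hypothesis Xc : compact [set: X].
Implicit Types A B : hyperspace X.

Lemma hausdorff_dist_lt A B (e : R) : hausdorff_dist A B < e ->
  hausdorff_radii A B e.
Proof.
move=> /inf_lt[|r [r0 AB BA] re]; first exact: hausdorff_radii_neq0.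
split; first exact: ltW (le_lt_trans r0 re).
  by move=> x /AB[y By xy]; exists y => //; exact: le_trans (ltW re).
by move=> x /BA[y By xy]; exists y => //; exact: le_trans (ltW re).
Qed.

(** Every [k]-tuple of centres misses some point by a margin that persists for nearby tuples; the
    tuples form a compact space by Tychonoff, so one margin serves all. It is doubled to allow
    moving both a centre and a point by [d]. *)
Lemma not_coverable_gap A n k : ~ coverable A n k ->
  exists2 d : R, 0 < d & forall c : 'I_k -> X,
    (forall i, hyperspace_set A (c i)) ->
    exists2 y, hyperspace_set A y & forall i, 2 ^- n + d + d < mdist (c i) y.
Proof.
move=> nA.
pose P (j : nat) (c : prod_topology (fun _ : 'I_k => X)) :=
  exists2 y, hyperspace_set A y &
    forall i, 2 ^- n + 2 ^- j + 2 ^- j < mdist (c i) y.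
have := @tychonoff _ (fun _ : 'I_k => X) (fun=> A : set X)
  (fun=> @hyperspace_compact _ _ A).
move=> /compact_near_coveringP/(_ nat \oo P _)[|N _ /(_ N (leqnn N)) NP];
  last first.
  by exists (2 ^- N); [rewrite exp2V_gt0|exact: NP].
move=> c /= Ac.
have [y Ay yc] : exists2 y, hyperspace_set A y &
    forall i, 2 ^- n < mdist (c i) y.
  apply: contrapT => /forall2NP no; apply: nA.
  exists [seq c i | i : 'I_k]; split; last by rewrite size_image card_ord.
    by move=> _ /mapP[i _ ->]; exact: Ac.
  move=> x Ax; have [//|/existsNP[i /negP]] := no x.
  by rewrite -leNgt => cix; exists (c i) => //; apply: map_f; rewrite mem_enum.
pose f (i : 'I_k) := [set cj : prod_topology (fun _ : 'I_k => X) * nat |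
  2 ^- n + 2 ^- cj.2 + 2 ^- cj.2 < mdist (cj.1 i) y].
suff fP : forall i, filter_prod (nbhs c) \oo (f i).
  have FF : Filter (filter_prod (nbhs c) \oo).
    by apply: filter_prod_filter; exact: nbhs_filter.
  have := @filter_forall _ _ f _ FF fP.
  by apply: filterS => -[c' j] /= c'j; exists y.
move=> i.
(* One third pays for moving the centre, the other two for the two terms [2 ^- j]. *)
have e0 : 0 < (mdist (c i) y - 2 ^- n) / 3 by rewrite divr_gt0// subr_gt0.
set e := _ / 3 in e0.
have [N Ne] := ex_exp2V_lt e0.
exists ([set c' | ball (c i) e (c' i)], [set j | (N <= j)%N]) => /=.
  split; last by exists N.
  exact: (@proj_continuous _ (fun _ : 'I_k => X) i c _ (nbhsx_ballx _ _ e0)).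
move=> [c' j]/= [cc' Nj].
have je : 2 ^- j < e by rewrite (le_lt_trans _ Ne)// ler_exp2V.
rewrite ballEmdist/= in cc'.
have := metric_triangle (c i) (c' i) y.
have : mdist (c i) y = 2 ^- n + 3 * e by rewrite /e mulrCA mulfV// mulr1; ring.
rewrite /f/=; lra.
Qed.

(** A cover of a nearby [B] by too few balls, its centres moved into [A], would contradict
    [not_coverable_gap]. *)
Lemma ncov_lsc A n :
  nbhs A [set B : hyperspace X | (ncov A n <= ncov B n)%N].
Proof.
have A0 := ncov_gt0 Xc n (hyperspace_neq0 A).
have [|d d0 dP] := @not_coverable_gap A n (ncov A n).-1.
  by move=> /(coverableP Xc); rewrite -ltnS prednK// ltnn.
apply/(@nbhs_ballP R (hyperspace X)); exists d => // B.
rewrite ballEmdist/= => /hausdorff_dist_lt.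
move=> [_ AB BA]; rewrite leqNgt; apply/negP; rewrite -(prednK A0) ltnS.
move=> /(coverableP Xc)[s [sB Bs sk]].
(* [p0] pads the list of centres when it is shorter than the tuples of the gap lemma. *)
have [p0 Bp0] := hyperspace_neq0 B.
have /choice[f fP] p : exists q,
    hyperspace_set B p -> hyperspace_set A q /\ mdist p q <= d.
  have [Bp|] := pselect (hyperspace_set B p); last by exists p.
  by have [q Aq pq] := BA p Bp; exists q.
have sB' i : hyperspace_set B (nth p0 s i).
  by have [si|si] := ltnP i (size s); [exact/sB/mem_nth|rewrite nth_default].
have [|y Ay yP] := dP (fun i => f (nth p0 s i)).
  by move=> i; have [] := fP _ (sB' i).
have [z Bz yz] := AB y Ay; have [p ps pz] := Bs z Bz.
have pk : (index p s < (ncov A n).-1)%N.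
  by rewrite (leq_trans _ sk)// index_mem.
have := yP (Ordinal pk); rewrite /= nth_index//; apply/negP; rewrite -leNgt.
have [_ pfp] := fP p (sB p ps).
rewrite (le_trans (metric_triangle _ p _))// [leRHS]addrC lerD//.
  by rewrite metric_sym.
by rewrite (le_trans (metric_triangle _ z _))// lerD// metric_sym.
Qed.

Lemma box_ratio_lsc n :
  lower_semicontinuous (fun A : hyperspace X => (box_ratio A n)%:E).
Proof.
move=> A a aA; exists [set B : hyperspace X | (ncov A n <= ncov B n)%N].
  exact: ncov_lsc.
move=> B AB; apply: lt_le_trans aA _; rewrite lee_fin.
exact: (box_ratio_le Xc (hyperspace_neq0 A) AB).
Qed.

Lemma analytic_upper_box_dim (CC : set (hyperspace X)) : compact CC ->
  analytic R [set upper_box_dim (C : set X) | C in CC].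
Proof.
move=> CCc; have := analytic_limn_esup CCc box_ratio_lsc.
congr (analytic R _); apply: eq_imagel => A _.
by rewrite (upper_box_dimE Xc (hyperspace_neq0 A)).
Qed.

End hyperspace_covering.
(** * Compact sets of prescribed dimension *)

Section growth.
Context {R : realType}.
Implicit Types a b s q : R.

Lemma affine_le_powR a b s q : s < q -> exists N, forall n, (N <= n)%N ->
  (a + b * n%:R) * 2 `^ (n%:R * s) <= 2 `^ (n%:R * q).
Proof.
move=> sq; have l2 : 0 < ln (2 : R) by rewrite ln_gt0// ltr1n.
pose d := (q - s) * ln 2; have d0 : 0 < d by rewrite mulr_gt0// subr_gt0.
(* Chosen so that for [n >= c] the quadratic term of [expR (d * n)] dominates [(|a| + |b|) * n]. *)
pose c := 2 * (`|a| + `|b|) / d ^+ 2.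
exists (Num.truncn c).+1 => n cn; have nc : c <= n%:R.
  by apply/ltW/(lt_le_trans (truncnS_gt _)); rewrite ler_nat.
have n1 : 1 <= n%:R :> R by rewrite ler1n (leq_trans _ cn).
have -> : 2 `^ (n%:R * q) = expR (d * n%:R) * 2 `^ (n%:R * s).
  rewrite /powR pnatr_eq0/= -expRD; congr expR; rewrite /d; ring.
rewrite ler_wpM2r ?powR_ge0//.
have dn0 : 0 <= d * n%:R by rewrite mulr_ge0// ltW.
apply: le_trans (expR_ge1Dxn 1 dn0); rewrite exprMn (_ : 2`! = 2%N)//.
have : 2 * (`|a| + `|b|) <= d ^+ 2 * n%:R.
  by rewrite [leRHS]mulrC -ler_pdivrMr// exprn_gt0.
move=> /(ler_wpM2r (ler0n R n)) h.
have ha := ler_norm a; have hb := ler_norm b.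
have hbn : b * n%:R <= `|b| * n%:R by rewrite ler_wpM2r.
have han : `|a| <= `|a| * n%:R by rewrite ler_peMr.
lra.
Qed.

Lemma powR2_ge1 q : 0 <= q -> 1 <= 2 `^ q.
Proof. by move=> q0; rewrite -[leLHS](powRr0 2) ler_powR ?ler1n. Qed.

End growth.

Section local_dimension.
Context (R : realType) (X : metricType R).
Hypothesis Xc : compact [set: X].
Hypothesis X0 : [set: X] !=set0.
Implicit Types (B : set X) (t : R).
Let d := upper_box_dim [set: X].

Lemma upper_box_dim_ge0 B : B !=set0 -> (0 <= upper_box_dim B)%E.
Proof.
move=> B0; rewrite upper_box_dimE//; apply/limn_esup_geP => q N q0.
exists N => //; apply: lt_le_trans q0 _; rewrite lee_fin.
by rewrite divr_ge0 ?mulr_ge0 ?ln_ge0 ?ler1n ?ncov_gt0.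
Qed.

(* The sets of upper box dimension less than [d]. *)
Definition small B := exists t c, [/\ (t%:E < d)%E, 0 <= c &
  forall n, (ncov B n)%:R <= c * 2 `^ (n%:R * t)].

Lemma setT_not_small : ~ small setT.
Proof.
move=> [t [c [td c0 tc]]]; move: (td); rewrite ltNge => /negP; apply.
rewrite /d upper_box_dimE//; apply/limn_esup_leP => q tq.
have [N Nq] := affine_le_powR c 0 tq; exists (maxn N 1) => n.
rewrite geq_max => /andP[Nn n0]; rewrite lee_fin box_ratio_le_powR//.
by apply: le_trans (tc n) _; have := Nq n Nn; rewrite mul0r addr0.
Qed.

(** Small sets form an ideal, so if every point had a small neighbourhood, [compact_ideal] would
    make the whole space small. *)
Lemma ex_not_small : exists x : X, forall U, nbhs x U -> ~ small U.
Proof.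
apply: contrapT => /forallNP H; apply: setT_not_small.
apply: (compact_ideal (P := small) Xc).
(* The exponent is negative because [d] may be 0. *)
- exists (-1), 0; split => // [|n]; last by rewrite ncov0// mul0r.
  by apply: lt_le_trans (upper_box_dim_ge0 X0); rewrite lte_fin ltrN10.
- move=> A B [t [c [td c0 tc]]] [s [b [sd b0 sb]]].
  exists (Num.max t s), (c + b); split; rewrite ?addr_ge0//.
    by rewrite /Num.max; case: ifP.
  move=> n; apply: (@le_trans _ _ ((ncov A n)%:R + (ncov B n)%:R)).
    by rewrite -natrD ler_nat ncovU.
  rewrite mulrDl lerD//.
    apply: le_trans (tc n) _; rewrite ler_wpM2l// ler_powR ?ler1n//.
    by rewrite ler_wpM2l// le_max lexx.
  apply: le_trans (sb n) _; rewrite ler_wpM2l// ler_powR ?ler1n//.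
  by rewrite ler_wpM2l// le_max lexx orbT.
- move=> A B AB [t [c [td c0 tc]]]; exists t, (c * 2 `^ t); split=> //.
    by rewrite mulr_ge0// powR_ge0.
  move=> n; apply: (@le_trans _ _ (ncov B n.+1)%:R).
    by rewrite ler_nat ncov_subset.
  apply: le_trans (tc n.+1) _; rewrite -mulrA -powRD ?pnatr_eq0 ?implybT//.
  by rewrite -(natr1 n) mulrDl mul1r addrC.
- move=> x _; have /existsNP[U /not_implyP[xU /contrapT Us]] := H x.
  by exists U.
Qed.

(* Dropping points one at a time, the last list for which some covering number
   exceeds the prescribed bound does so by at most one. *)
Lemma prune (h : nat -> R) (s : seq X) :
  (exists n, h n < (ncov [set` s] n)%:R) -> (forall n, 0 <= h n) ->
  exists s' : seq X, [/\ {subset s' <= s},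
    exists n, h n < (ncov [set` s'] n)%:R &
    forall n, (ncov [set` s'] n)%:R <= h n + 1].
Proof.
move=> + h0; elim: s => [[n]|p s IHs [n hn]].
  by rewrite set_nil ncov0// ltNge h0.
have [/IHs[s' [s's s'h s'1]]|] :=
  pselect (exists n, h n < (ncov [set` s] n)%:R).
  by exists s'; split => // y /s's; rewrite inE orbC => ->.
move=> /forallNP sh; exists (p :: s); split => //; first by exists n.
move=> k; have /negP := sh k; rewrite -leNgt => hk.
have -> : [set` p :: s] = [set p] `|` [set` s].
  apply/seteqP; split=> y /=; rewrite inE; first by case/predU1P; [left|right].
  by case=> [->|->]; rewrite ?eqxx ?orbT.
apply: (@le_trans _ _ (ncov [set p] k + ncov [set` s] k)%:R).
  by rewrite ler_nat ncovU.
rewrite natrD addrC lerD// lern1 (@ncov_le1 _ _ Xc _ _ p)// => y ->.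
by rewrite mdistxx exp2V_ge0.
Qed.

(** A fine net of a small ball about [x] exceeds the bound somewhere, and [prune] cuts it down until
    it barely does. The exponent [n.+1] anticipates the level lost when the piece is put into a
    larger set. *)
Lemma ex_piece (x : X) : (forall U, nbhs x U -> ~ small U) ->
  forall t m, (t%:E < d)%E -> exists s : seq X,
  [/\ s != [::], forall p, p \in s -> mdist x p <= 2 ^- m,
    exists2 n, (m <= n)%N & 2 `^ (n.+1%:R * t) < (ncov [set` s] n)%:R &
    forall n, (ncov [set` s] n)%:R <= 2 `^ (n.+1%:R * t) + 1].
Proof.
(* For negative [t] the powers are below 1 and a single point suffices; when [d = 0] this is the
   only case. *)
move=> xS t m td; have [t0|t0] := ltP t 0.
  exists [:: x]; split => //.
  - by move=> p; rewrite inE => /eqP ->; rewrite mdistxx exp2V_ge0.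
  - exists m => //; apply: (@lt_le_trans _ _ 1).
      rewrite /powR pnatr_eq0/= expR_lt1.
      by rewrite pmulr_llt0 ?ln_gt0 ?ltr1n// pmulr_rlt0.
    by rewrite ler1n ncov_gt0//; exists x; rewrite /= mem_head.
  - move=> n; rewrite -[leLHS]add0r lerD ?powR_ge0// lern1.
    apply: (@ncov_le1 _ _ Xc _ _ x); first by rewrite /= mem_head.
    by move=> y /=; rewrite inE => /eqP ->; rewrite mdistxx exp2V_ge0.
pose U := ball x (2 ^- m.+1).
have xU : nbhs x U by apply: nbhsx_ballx; rewrite exp2V_gt0.
(* Replacing [U] by its net moves the excess to level [n.+1], where the bound to beat has exponent
   [n.+2]. *)
have [n Un] : exists n, 2 `^ (n.+2%:R * t) < (ncov U n)%:R.
  apply: contrapT => /forallNP Un; apply: (xS U xU).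
  exists t, (2 `^ (2 * t)); split; rewrite ?powR_ge0// => n.
  have /negP := Un n; rewrite -leNgt => /le_trans; apply.
  by rewrite -powRD ?pnatr_eq0 ?implybT// -mulrDl -natrD add2n.
have /coverableP[//|s [sU Us _]] := leqnn (ncov U n.+1).
have Us' : (ncov U n <= ncov [set` s] n.+1)%N.
  have /coverableP[//|r [rs sr rk]] := leqnn (ncov [set` s] n.+1).
  apply/coverableP => //; exists r; split => // [p /rs/sU//|y /Us[p ps py]].
  have [z zr zp] := sr p ps; exists z => //.
  by rewrite exp2V_double (le_trans (metric_triangle _ p _))// lerD.
have [||s' [s's [k s'k] s'1]] := @prune (fun n => 2 `^ (n.+1%:R * t)) s.
- by exists n.+1; apply: lt_le_trans Un _; rewrite ler_nat.
- by move=> ?; exact: powR_ge0.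
have s'0 : s' != [::].
  apply: contraTneq s'k => ->; rewrite set_nil ncov0// -leNgt; exact: powR_ge0.
have s'U p : p \in s' -> mdist x p < 2 ^- m.+1.
  by move=> /s's/sU; rewrite /U ballEmdist.
exists s'; split => //.
  move=> p /s'U/ltW/le_trans; apply.
  by rewrite ler_exp2V.
(* Below level [m] a single ball covers the piece, while the bound is at least 1. *)
exists k => //; rewrite leqNgt; apply/negP => km; move: s'k; apply/negP.
rewrite -leNgt; apply: (@le_trans _ _ 1); last first.
  by rewrite powR2_ge1// mulr_ge0.
case: s' s'0 s'U {s's s'1} => // p s' _ s'U; rewrite lern1.
apply: (@ncov_le1 _ _ Xc _ _ p); first by rewrite /= mem_head.
move=> y /= ys; apply: (@le_trans _ _ (2 ^- m)).
  rewrite exp2V_double (le_trans (metric_triangle _ x _))// lerD// ltW ?s'U//.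
  by rewrite metric_sym s'U ?mem_head.
by rewrite ler_exp2V// ltnW.
Qed.

End local_dimension.

Section bouquet.
Context (R : realType) (X : metricType R).
Context (x : X) (D : nat -> seq X).

Definition bouquet : set X := [set x] `|` \bigcup_m [set` D m].

Hypothesis Xc : compact [set: X].
Hypothesis Dx : forall m p, p \in D m -> mdist x p <= 2 ^- m.

Let dist_tail M m p : (M <= m)%N -> p \in D m -> mdist x p <= 2 ^- M.
Proof.
move=> Mm /Dx/le_trans; apply.
by rewrite ler_exp2V.
Qed.

(** For each [M] the bouquet lies in a closed ball of radius [2 ^- M] about [x] joined with finitely
    many finite pieces, and it is the intersection of these closed sets. *)
Lemma bouquet_compact : compact bouquet.
Proof.
apply: (@subclosed_compact _ _ setT) => //.
rewrite (_ : bouquet = \bigcap_M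
    ([set y | mdist x y <= 2 ^- M] `|` \bigcup_(m in `I_M) [set` D m])).
  apply: closed_bigI => M _; apply: closedU.
    rewrite -openC openE => y /= /negP; rewrite -ltNge => My.
    apply/nbhs_ballP; exists (mdist x y - 2 ^- M); rewrite /= ?subr_gt0// => z.
    rewrite ballEmdist/= => yz xz; have := metric_triangle x z y.
    by rewrite [mdist z y]metric_sym; lra.
  apply: closed_bigcup => [|m _]; first exact: finite_II.
  apply: compact_closed.
    exact: metric_hausdorff.
  by apply: finite_compact; exact: finite_seq.
apply/seteqP; split => [y [->|[m _ ym]] M _|y yM].
- by left; rewrite /= mdistxx exp2V_ge0.
- have [mM|Mm] := ltnP m M; last by left; exact: dist_tail ym.
  by right; exists m.
have [xy|xy] := eqVneq (mdist x y) 0.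
  by left; rewrite /= (mdist_positivity _ _ xy).
have xy0 : 0 < mdist x y by rewrite lt_neqAle mdist_ge0 eq_sym xy.
have [M] := ex_exp2V_lt xy0; rewrite ltNge => /negP Mxy.
have [//|[m _ ym]] := yM M I.
by right; exists m.
Qed.

(** One ball about [x] contains all pieces of index at least [n]; the other [n] pieces cost at most
    [b] each. *)
Lemma ncov_bouquet_le n (b : R) : (forall m, (ncov [set` D m] n)%:R <= b) ->
  (ncov bouquet n)%:R <= 1 + b * n%:R.
Proof.
move=> Db; pose B := [set x] `|` \bigcup_(m in [set m | (n <= m)%N]) [set` D m].
have -> : bouquet = B `|` \bigcup_(m in `I_n) [set` D m].
  apply/seteqP; split => [y [->|[m _ ym]]|y [[->|[m _ ym]]|[m _ ym]]].
  - by left; left.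
  - by have [mn|nm] := ltnP m n; [right|left; right]; exists m.
  - by left.
  - by right; exists m.
  - by right; exists m.
(* The induction is on the number of pieces, with the level [n] fixed. *)
elim: {1 3}n => [|k IHk].
  rewrite II0 bigcup_set0 setU0 mulr0 addr0 lern1.
  apply: (@ncov_le1 _ _ Xc _ _ x); first by left.
  move=> y [->|[m /= nm ym]]; first by rewrite mdistxx exp2V_ge0.
  exact: dist_tail ym.
rewrite IIS bigcup_setU bigcup_set1 setUA -natr1 mulrDr mulr1 addrA.
apply: le_trans (lerD IHk (Db k)); rewrite -natrD ler_nat.
exact: ncovU.
Qed.

Lemma upper_box_dim_bouquet (t : nat -> R) (l : \bar R) : (0 <= l)%E ->
  (forall m, [/\ D m != [::],
    exists2 n, (m <= n)%N & 2 `^ (n.+1%:R * t m) < (ncov [set` D m] n)%:R &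
    forall n, (ncov [set` D m] n)%:R <= 2 `^ (n.+1%:R * t m) + 1]) ->
  (forall q : rat, (l < (ratr q)%:E)%E -> \forall m \near \oo, t m <= ratr q) ->
  (forall q : rat, ((ratr q)%:E < l)%E -> \forall m \near \oo, ratr q < t m) ->
  upper_box_dim bouquet = l.
Proof.
move=> l0 DP tl lt; have C0 : bouquet !=set0 by exists x; left.
rewrite upper_box_dimE//; apply/eqP; rewrite eq_le; apply/andP; split.
  apply/limn_esup_leP => q /lt_ereal_rat[s /andP[ls]]; rewrite lte_fin => sq.
  have s0 : 0 < ratr s :> R by rewrite -lte_fin (le_lt_trans l0).
  have [M _ Ms] := tl s ls.
  pose A : R := (\sum_(m < M) size (D m))%:R.
  (* [A] bounds the covering numbers of the first [M] pieces at every level; the second term absorbs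
     the [+ 1] and the shift [n.+1] for the others. *)
  pose c := A + 2 * 2 `^ ratr s.
  have [N Nq] := affine_le_powR 1 c sq; exists (maxn N 1) => n.
  rewrite geq_max => /andP[Nn n0]; rewrite lee_fin box_ratio_le_powR//.
  apply: le_trans (Nq n Nn).
  have p1 : 1 <= 2 `^ (n%:R * ratr s) :> R.
    by rewrite powR2_ge1// mulr_ge0// ltW.
  apply: (@le_trans _ _ (1 + (c * 2 `^ (n%:R * ratr s)) * n%:R)); last first.
    by rewrite [leRHS]mulrDl mul1r mulrAC lerD.
  apply: ncov_bouquet_le => m; rewrite /c mulrDl.
  have [mM|Mm] := ltnP m M.
    apply: (@le_trans _ _ A).
      rewrite ler_nat (bigD1 (Ordinal mM))//=.
      apply: leq_trans (leq_addr _ _); apply/coverableP => //.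
      exists (D m); split => // y ym; exists y => //.
      by rewrite mdistxx exp2V_ge0.
    by rewrite -[leLHS]addr0 lerD ?ler_peMr ?mulr_ge0 ?powR_ge0.
  have [_ _ /(_ n)/le_trans->//] := DP m.
  have e : 2 `^ (n.+1%:R * ratr s) = 2 `^ ratr s * 2 `^ (n%:R * ratr s) :> R.
    rewrite -powRD ?pnatr_eq0 ?implybT//; congr (_ `^ _).
    by rewrite -(natr1 n); ring.
  have h1 : 2 `^ (n.+1%:R * t m) <= 2 `^ (n.+1%:R * ratr s).
    by rewrite ler_powR ?ler1n// ler_wpM2l// Ms.
  have h2 : 1 <= 2 `^ ratr s :> R by rewrite powR2_ge1// ltW.
  have h3 : 1 <= 2 `^ (n.+1%:R * ratr s) :> R.
    by rewrite powR2_ge1// mulr_ge0// ltW.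
  have h4 : 0 <= A * 2 `^ (n%:R * ratr s) by rewrite mulr_ge0 ?powR_ge0// ler0n.
  rewrite -[2 * _ * _]mulrA -e.
  move: h1 h3 h4; lra.
apply/limn_esup_geP => q N /lt[M _ Mq].
have [_ [n mn Dn] _] := DP (maxn M N).
exists n.+1; first by rewrite leqW// (leq_trans _ mn)// leq_maxr.
rewrite lte_fin (lt_trans (Mq (maxn M N) (leq_maxl _ _)))// lt_box_ratio//.
apply: lt_le_trans Dn _; rewrite ler_nat; apply: ncov_subset => //.
by move=> y yD; right; exists (maxn M N).
Qed.

End bouquet.
(** * Analytic sets as sets of limits over the Cantor space *)

(** An odd multiple of [2 ^ i], as large as desired. *)
Lemma ex_logn2 (i M : nat) : exists2 m, (M <= m)%N & logn 2 m = i.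
Proof.
exists (2 ^ i * M.*2.+1)%N.
  rewrite (@leq_trans M.*2.+1)//; first by rewrite -addnn leqW// leq_addr.
  by rewrite leq_pmull// expn_gt0.
rewrite lognM ?expn_gt0// pfactorK// lognE/= dvdn2/= odd_double/=.
by rewrite addn0.
Qed.

Section jumps.
Context (T : Type) (R : realType) (d : T -> T -> R) (q : nat -> T).
Hypothesis dxx : forall x y, d x y = 0 <-> x = y.
Hypothesis dC : forall x y, d x y = d y x.
Hypothesis dT : forall x y z, d x z <= d x y + d y z.

(* The state is a point together with the number of jumps made so far. The
   point proposed at time [m] is [q (logn 2 m)], so that every [q i] is proposed
   infinitely often; the bit [z m] decides whether to jump to it, and the [l]th
   jump has length less than [2 ^- l] for [0 < l]. *)
Fixpoint jump_state (z : nat -> bool) m : T * nat :=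
  if m is k.+1 then
    let: (y, l) := jump_state z k in
    if z k && ((l == 0%N) || (d y (q (logn 2 k)) < 2 ^- l))
    then (q (logn 2 k), l.+1) else (y, l)
  else (q 0, 0%N).

Lemma eq_jump_state z z' m : (forall i, (i < m)%N -> z i = z' i) ->
  jump_state z m = jump_state z' m.
Proof.
elim: m => //= m IHm zz'; rewrite zz'// IHm// => i im.
by apply: zz'; rewrite ltnS ltnW.
Qed.

Let dge0 x y : 0 <= d x y.
Proof.
have := dT x y x; rewrite (_ : d x x = 0); last exact/dxx.
by rewrite [d y x]dC -mulr2n pmulrn_lge0.
Qed.

Lemma jump_state_mono z : {homo (fun m => (jump_state z m).2) :
  m n / (m <= n)%N >-> (m <= n)%N}.
Proof.
apply: homo_leq => [//|? ? ?|m]; first exact: leq_trans.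
by rewrite /=; case: (jump_state z m) => y l; case: ifP => //=.
Qed.

(** The sum telescopes, as [2 ^- l = 2 * (2 ^- l - 2 ^- l.+1)]. A jump must already have been made,
    since the first one has unrestricted length. *)
Lemma jump_state_dist z m n : (m <= n)%N -> (0 < (jump_state z m).2)%N ->
  d (jump_state z m).1 (jump_state z n).1 <=
  2 * (2 ^- (jump_state z m).2 - 2 ^- (jump_state z n).2).
Proof.
move=> mn m0; elim: n mn => [|n IHn].
  by rewrite leqn0 => /eqP ->; rewrite subrr mulr0 (_ : d _ _ = 0)//; exact/dxx.
rewrite leq_eqVlt ltnS => /predU1P[<-|mn].
  by rewrite subrr mulr0 (_ : d _ _ = 0)//; exact/dxx.
have := IHn mn; have := jump_state_mono z mn => /=.
case: (jump_state z n) => y l /= ml IH; case: ifP => //= /andP[_].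
rewrite eqn0Ngt (leq_trans m0 ml)/= => /ltW yq.
apply: le_trans (dT _ y _) _; apply: le_trans (lerD IH yq) _.
by rewrite [in leRHS]exprS invfM; lra.
Qed.

(** Either the jumps stop and the walk is eventually constant, or their number is unbounded and
    [jump_state_dist] bounds the tails. *)
Lemma jump_state_cauchy z (e : R) : 0 < e -> exists N, forall m n,
  (N <= m)%N -> (N <= n)%N -> d (jump_state z m).1 (jump_state z n).1 < e.
Proof.
move=> e0; have [[L lL]|lL] :=
    pselect (exists L, forall m, ((jump_state z m).2 <= L)%N).
  have exP : exists l, `[<exists m, l = (jump_state z m).2>].
    by exists (jump_state z 0).2; apply/asboolP; exists 0%N.
  have ubP l : `[<exists m, l = (jump_state z m).2>] -> (l <= L)%N.
    by move=> /asboolP[m ->].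
  have [_ /asboolP[m0 ->] lmax] := ex_maxnP exP ubP.
  have const n : (m0 <= n)%N -> jump_state z n = jump_state z m0.
    elim: n => [|n IHn]; first by rewrite leqn0 => /eqP ->.
    rewrite leq_eqVlt ltnS => /predU1P[<-//|/[dup] mn /IHn] /=.
    have : ((jump_state z n.+1).2 <= (jump_state z m0).2)%N.
      by apply: lmax; apply/asboolP; exists n.+1.
    rewrite /=; case: (jump_state z n) => y l; case: ifP => //= _ /[swap] <-/=.
    by rewrite ltnn.
  by exists m0 => m n /const-> /const->; rewrite (_ : d _ _ = 0)//; exact/dxx.
have e40 : 0 < e / 4 by rewrite divr_gt0.
have [L Le] := ex_exp2V_lt e40.
have [N LN] : exists N, (L < (jump_state z N).2)%N.
  apply: contrapT => /forallNP lN; apply: lL; exists L => m.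
  by rewrite leqNgt; apply/negP.
have Nd m : (N <= m)%N -> d (jump_state z N).1 (jump_state z m).1 < e / 2.
  move=> Nm; apply: le_lt_trans (jump_state_dist Nm _) _.
    exact: leq_ltn_trans LN.
  have : 2 ^- (jump_state z N).2 <= 2 ^- L :> R.
    by rewrite ler_exp2V// ltnW.
  have : 0 < 2 ^- (jump_state z m).2 :> R by rewrite exp2V_gt0.
  lra.
exists N => m n Nm Nn; apply: le_lt_trans (dT _ (jump_state z N).1 _) _.
by rewrite [e]splitr ltrD ?Nd// dC Nd.
Qed.

Hypothesis q_dense : forall y (e : R), 0 < e -> exists i, d (q i) y < e.

(* Jump whenever the proposed point is within [2 ^- (l + 2)] of the target. *)
Lemma jump_state_reach y : exists z, forall e : R, 0 < e ->
  exists N, forall m, (N <= m)%N -> d y (jump_state z m).1 < e.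
Proof.
pose fix S m : T * nat := if m is k.+1 then
  if d (q (logn 2 k)) y < 2 ^- (S k).2.+2
  then (q (logn 2 k), (S k).2.+1) else S k else (q 0, 0%N).
pose z m := d (q (logn 2 m)) y < 2 ^- (S m).2.+2.
have Sclose m : (0 < (S m).2)%N -> d (S m).1 y < 2 ^- (S m).2.+1.
  by elim: m => //= m IHm; case: ifP.
have zS m : jump_state z m = S m.
  elim: m => //= m ->; rewrite /z; have := Sclose m.
  case: (S m) => x l /= xl; case qy: (d (q _) y < _) => //=.
  have [->//|l0] := posnP l; case: ifP => // /negP[].
  (* After [l] jumps the walk is within [2 ^- l.+1] of the target, so the desired jump is short
     enough to be allowed. *)
  rewrite exp2V_double; apply: le_lt_trans (dT _ y _) _.
  by rewrite ltrD ?xl// dC (lt_le_trans qy)// ler_exp2V.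
(* A suitable [q i] is proposed again after time [m]; by then the walk has either made a further
   jump or jumps to it. *)
have Sinf L : exists m, (L <= (S m).2)%N.
  elim: L => [|L [m Lm]]; first by exists 0%N.
  have [|i iy] := q_dense y (e := 2 ^- L.+2); first by rewrite exp2V_gt0.
  have [k mk ki] := ex_logn2 i m; exists k.+1.
  have := jump_state_mono z mk; rewrite !zS => /(leq_trans Lm) /=.
  rewrite leq_eqVlt => /predU1P[Lk|Lk]; first by rewrite ki -Lk iy.
  by case: ifP => // _; rewrite ltnW.
exists z => e e0.
have [L Le] := ex_exp2V_lt e0; have [N LN] := Sinf L.+1; exists N => m Nm.
have Lm : (L < (S m).2)%N.
  by apply: leq_trans LN _; have := jump_state_mono z Nm; rewrite !zS.
rewrite zS dC; apply: lt_trans (Sclose m _) _; first exact: leq_ltn_trans Lm.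
by apply: le_lt_trans Le; rewrite ler_exp2V// ltnW// ltnW.
Qed.

End jumps.

(** [A] need not be compact, hence need not be a continuous image of the Cantor space. It is still a
    set of pointwise limits of functions of finitely many bits: the images under [f] of the
    positions of the walk. *)
Lemma analytic_cantor_limits (R : realType) (Y : topologicalType) (A : set Y) :
  analytic R A -> A !=set0 -> exists g : nat -> (nat -> bool) -> Y,
  [/\ forall m z, A (g m z),
    forall m z z', (forall i, (i < m)%N -> z i = z' i) -> g m z = g m z',
    forall z, exists2 a, A a & g ^~ z @ \oo --> a &
    forall a, A a -> exists z, g ^~ z @ \oo --> a].
Proof.
move=> [T [f [[[D Dc Dd] [d [dxx dC dT dnbhs dcomp]]] fc <-]]] [_ [t0 _ _]].
have [q Dq] : exists q : nat -> T, D `<=` range q.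
  have /countable_injP[c cinj] := Dc.
  exists (fun n => xget t0 [set t | D t /\ c t = n]) => t Dt.
  exists (c t) => //; case: xgetP => [u _ [Du cu]|/(_ t)[]//].
  by apply: cinj => //; rewrite inE.
have q_dense y (e : R) : 0 < e -> exists i, d (q i) y < e.
  move=> e0; have yU : nbhs y [set x | d y x < e].
    by rewrite dnbhs; exists e.
  have U0 : [set x | d y x < e]^° !=set0 by exists y.
  have [x [yx Dx]] := Dd _ U0 (@open_interior _ _).
  have [i _ qi] := Dq x Dx; exists i; rewrite qi dC.
  exact: (interior_subset yx).
have cvgd (u : nat -> T) l : (forall e : R, 0 < e ->
    exists N, forall m, (N <= m)%N -> d l (u m) < e) -> u @ \oo --> l.
  move=> ul V; rewrite dnbhs => -[e /= /ul[N uN] eV].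
  by exists N => // m /= /uN/eV.
exists (fun m z => f (jump_state d q z m).1); split.
- by move=> m z; exists (jump_state d q z m).1.
- by move=> m z z' zz'; rewrite (eq_jump_state _ _ zz').
- move=> z; have [l ul] := dcomp _ (jump_state_cauchy q dxx dC dT z).
  by exists (f l) => //; exact: (cvg_comp _ _ ul (fc l)).
- move=> _ [y _ <-]; have [z zy] := jump_state_reach dC dT q_dense y.
  exists z; apply: (cvg_comp (fun m => (jump_state d q z m).1) f _ (fc y)).
  exact: cvgd.
Qed.

(** * The compact family realizing an analytic set *)

Section bouquet_hyperspace.
Context (R : realType) (X : metricType R).
Context (Xc : compact [set: X]) (x : X) (D : nat -> seq X).
Hypothesis Dx : forall m p, p \in D m -> mdist x p <= 2 ^- m.

Lemma bouquet_neq0 : bouquet x D !=set0.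
Proof. by exists x; left. Qed.

Definition bouquet_hyperspace : hyperspace X :=
  Hyperspace (bouquet_compact Xc Dx) bouquet_neq0.

End bouquet_hyperspace.

(** The pieces that differ lie within [2 ^- M] of the common point [x]. *)
Lemma hausdorff_dist_bouquet (R : realType) (X : metricType R)
    (Xc : compact [set: X]) (x : X) (D E : nat -> seq X)
    (Dx : forall m p, p \in D m -> mdist x p <= 2 ^- m)
    (Ex : forall m p, p \in E m -> mdist x p <= 2 ^- m) (M : nat) :
  (forall m, (m < M)%N -> D m = E m) ->
  hausdorff_dist (bouquet_hyperspace Xc Dx) (bouquet_hyperspace Xc Ex)
    <= 2 ^- M.
Proof.
move=> DE; have M0 : 0 <= 2 ^- M :> R by rewrite exp2V_ge0.
have sub F G : (forall m p, p \in F m -> mdist x p <= 2 ^- m) ->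
    (forall m, (m < M)%N -> F m = G m) ->
    bouquet x F `<=` thickening (bouquet x G) (2 ^- M).
  move=> Fx FG y [->|[m _ yF]]; first by exists x; [left|rewrite mdistxx].
  have [mM|Mm] := ltnP m M.
    by exists y; [right; exists m => //; rewrite -FG|rewrite mdistxx].
  exists x; [by left|rewrite metric_sym (le_trans (Fx _ _ yF))//].
  by rewrite ler_exp2V.
by apply: hausdorff_dist_le; split => //; apply: sub => // m /DE.
Qed.

Lemma nbhs_cantor (z : cantor_space) (M : nat) :
  nbhs z [set z' : cantor_space | forall i, (i < M)%N -> z i = z' i].
Proof.
elim: M => [|M IHM]; first by apply: filterS filterT => z' _ i.
have zM : nbhs z [set z' : cantor_space | z M = z' M].
  apply: (@proj_continuous _ (fun _ : nat => bool) M z [set b | z M = b]).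
  by rewrite nbhs_principalE; exact/principal_filterP.
apply: filterS (filterI IHM zM) => z' [/= zz' zM'] i.
by rewrite ltnS leq_eqVlt => /predU1P[->//|/zz'].
Qed.

(** Pieces exist only for values below [d], so the value [d] itself, possibly infinite, must be
    approached from below. *)
Lemma ex_lt_cvg (R : realType) (d : \bar R) : (0 <= d)%E ->
  exists u : nat -> R, (forall m, ((u m)%:E < d)%E) /\
    forall s : R, (s%:E < d)%E -> \forall m \near \oo, s < u m.
Proof.
case: d => [r _|_|//].
  exists (fun m => r - m.+1%:R^-1); split=> [m|s].
    by rewrite lte_fin ltrBlDr ltrDl invr_gt0.
  rewrite lte_fin -subr_gt0 => rs.
  have [N _ Nrs] := near_infty_natSinv_lt (PosNum rs).
  by exists N => // m /Nrs/=; rewrite ltrBrDr -ltrBrDl.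
exists (fun m => m%:R); split=> [m|s _]; first exact: ltry.
exact: nbhs_infty_gtr.
Qed.

Lemma compact_of_analytic (R : realType) (X : metricType R)
    (X0 : [set: X] !=set0) (Xc : compact [set: X]) (A : set (\bar R)) :
  A `<=` [set` `[0%E, upper_box_dim [set: X]]] -> analytic R A ->
  exists2 CC : set (hyperspace X), compact CC &
    [set upper_box_dim (C : set X) | C in CC] = A.
Proof.
move=> Ad Aan; have [->|/set0P A0] := eqVneq A set0.
  by exists set0; [exact: compact0|rewrite image_set0].
have [g [gA geq gcvg greach]] := analytic_cantor_limits Aan A0.
have [x xS] := ex_not_small Xc X0.
have [u [ud uq]] := ex_lt_cvg (upper_box_dim_ge0 Xc X0).
(* The piece is a function of its value and index alone, so it depends on no more bits of [z] than
   its value does. *)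
have /choice[P PP] (tm : R * nat) : exists s : seq X,
    (tm.1%:E < upper_box_dim [set: X])%E ->
    [/\ s != [::], forall p, p \in s -> mdist x p <= 2 ^- tm.2,
    exists2 n, (tm.2 <= n)%N & 2 `^ (n.+1%:R * tm.1) < (ncov [set` s] n)%:R &
    forall n, (ncov [set` s] n)%:R <= 2 `^ (n.+1%:R * tm.1) + 1].
  have [td|td] := pselect (tm.1%:E < upper_box_dim [set: X])%E.
    by have [s sP] := ex_piece Xc xS tm.2 td; exists s.
  by exists [::].
have A_ge0 a : A a -> (0 <= a)%E by move=> /Ad; rewrite /= in_itv => /andP[].
have A_le a : A a -> (a <= upper_box_dim [set: X])%E.
  by move=> /Ad; rewrite /= in_itv => /andP[].
(* Truncating at [u m] makes the value finite and less than the dimension of the space, without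
   changing the limit, which is at most that dimension. *)
pose t (z : cantor_space) m := fine (Order.min (g m z) (u m)%:E).
have tE z m : (t z m)%:E = Order.min (g m z) (u m)%:E.
  rewrite fineK// minEle; case: ifP => // gu.
  by rewrite ge0_fin_numE ?A_ge0// (le_lt_trans gu)// ltry.
have td z m : ((t z m)%:E < upper_box_dim [set: X])%E.
  by rewrite tE gt_min ud orbT.
pose D z m := P (t z m, m).
have Dx z m p : p \in D z m -> mdist x p <= 2 ^- m.
  by have [_ + _ _] := PP (t z m, m) (td z m); exact.
pose B z := bouquet_hyperspace Xc (Dx z).
have Bdim z a : A a -> g ^~ z @ \oo --> a -> upper_box_dim (B z : set X) = a.
  move=> Aa ga; apply: (upper_box_dim_bouquet Xc (Dx z) (A_ge0 a Aa)).
  - by move=> m; have [] := PP (t z m, m) (td z m); split; eassumption.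
  - move=> q aq; have : \forall m \near \oo, (g m z < (ratr q)%:E)%E.
      apply: (ga [set b | (b < (ratr q)%:E)%E]); apply: open_nbhs_nbhs.
      by split => //; exact: open_ereal_lt_ereal.
    by apply: filterS => m gq; rewrite -lee_fin tE ge_min (ltW gq).
  - move=> q qa; have gq : \forall m \near \oo, ((ratr q)%:E < g m z)%E.
      apply: (ga [set b | ((ratr q)%:E < b)%E]); apply: open_nbhs_nbhs.
      by split => //; exact: open_ereal_gt_ereal.
    apply: filterS2 gq (uq _ (lt_le_trans qa (A_le a Aa))) => m gq qu.
    by rewrite -lte_fin tE lt_min gq lte_fin.
exists (B @` setT).
  apply: continuous_compact; last exact: cantor_space_compact.
  apply: continuous_subspaceT => z V /nbhs_ballP[e /= e0 eV].
  have [M Me] := ex_exp2V_lt e0.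
  apply: filterS (nbhs_cantor z M) => z' zz'; apply: eV.
  rewrite ballEmdist/= (le_lt_trans _ Me)//; apply: hausdorff_dist_bouquet.
  move=> m mM; congr (P (_, m)); congr (fine (Order.min _ _)).
  by apply: geq => i im; apply: zz'; exact: ltn_trans mM.
apply/seteqP; split=> [_ [_ [z _ <-] <-]|a Aa].
  by have [a Aa /(Bdim _ _ Aa)->] := gcvg z.
by have [z /(Bdim _ _ Aa) <-] := greach a Aa; exists (B z) => //; exists z.
Qed.

Theorem theorem4p7 (R : realType) (K : metricType R)
    (K_neq0 : [set: K] !=set0) (K_compact : compact [set: K])
    (A : set (\bar R))
    (A_sub : A `<=` [set` `[0%E, upper_box_dim [set: K]]]) :
  (exists2 CC : set (hyperspace K), compact CC &
    [set upper_box_dim (C : set K) | C in CC] = A)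
  <-> analytic R A.
Proof.
split=> [[CC CCc <-]|]; first exact: analytic_upper_box_dim.
exact: compact_of_analytic.
Qed.
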